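(* Let $K$ be an algebraically closed field. For all integers $m \geq 1$ and $d_0, d_1 \geq 0$, the variety $\mathcal{X}_m(d_0, d_1)$ is irreducible.
   Context: $K$ is an algebraically closed field; varieties carry the Zariski topology. For $m \geq 1$ and $d_0, d_1 \geq 0$, $\mathcal{X}_m(d_0,d_1)$ is the affine variety consisting of the triples $M = (M_0, M_1, h_M)$, where $M_0$ is a $(d_0 \times d_0)$-matrix, $M_1$ is a $(d_1 \times d_1)$-matrix and $h_M$ is a $(d_0 \times d_1)$-matrix, all with entries in $K$, such that $M_0^m = 0$, $M_1^m = 0$ and $M_0 h_M = h_M M_1$. By convention, if $d', d'' \geq 0$ and $d' = 0$ or $d'' = 0$, then there is a unique $(d' \times d'')$-matrix, which behaves like zero with respect to multiplication. *)

(* Defs.v *)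
From HB Require Import structures.
From mathcomp Require Import all_boot all_algebra.
From mathcomp Require Import mpoly.

Set Implicit Arguments.
Unset Strict Implicit.
Unset Printing Implicit Defensive.

Import GRing.Theory.
Local Open Scope ring_scope.

Section Zariski.

Variables (K : fieldType) (n : nat).
Implicit Types (X Z : 'rV[K]_n -> Prop) (S : {mpoly K[n]} -> Prop).

Definition zero_locus S : 'rV[K]_n -> Prop :=
  fun v => forall p : {mpoly K[n]}, S p -> p.@[fun i => v 0 i] = 0.

(* Z is a closed subset of X for the topology induced on X by the Zariski
   topology of the affine space K^n. *)
Definition zariski_closed_in X Z : Prop :=
  exists S, forall v, Z v <-> X v /\ zero_locus S v.

(* In particular the empty set is not irreducible. *)
Definition zariski_irreducible X : Prop :=
  (exists v, X v) /\
  forall Z1 Z2, zariski_closed_in X Z1 -> zariski_closed_in X Z2 ->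
    (forall v, X v -> Z1 v \/ Z2 v) ->
    (forall v, X v -> Z1 v) \/ (forall v, X v -> Z2 v).

End Zariski.

Section Triples.

Variables (K : fieldType) (d0 d1 : nat).

Record triple := Triple {
  mat0 : 'M[K]_d0;
  mat1 : 'M[K]_d1;
  hmat : 'M[K]_(d0, d1)
}.

Definition coords (M : triple) : 'rV[K]_(d0 * d0 + d1 * d1 + d0 * d1) :=
  row_mx (row_mx (mxvec (mat0 M)) (mxvec (mat1 M))) (mxvec (hmat M)).

(* The variety X_m(d0, d1), as a subset of the affine space of coordinate
   vectors; coords is a linear bijection between triples and such vectors. *)
Definition Xvar (m : nat) : 'rV[K]_(d0 * d0 + d1 * d1 + d0 * d1) -> Prop :=
  fun v => exists2 M : triple,
    [/\ mat0 M ^+ m = 0, mat1 M ^+ m = 0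
      & mat0 M *m hmat M = hmat M *m mat1 M]
    & coords M = v.

End Triples.

(* Main.v *)
Require Import Defs.
From mathcomp Require Import all_boot all_algebra.
From mathcomp Require Import mpoly.
From mathcomp Require Import ring zify.
From Stdlib Require Import Classical.

Set Implicit Arguments.
Unset Strict Implicit.
Unset Printing Implicit Defensive.

Import GRing.Theory.
Local Open Scope ring_scope.

(** Write A, B for the two nilpotent matrices and let them act on row vectors
from the right: A and B are then finite-dimensional modules over K[x]/(x^m),
and A h = h B says that h is a homomorphism from the first to the second.

Irreducibility means that if one polynomial function is nonzero at some point
of the variety and another one at some other point, then some point makes both
nonzero.  Points are moved along polynomial curves t |-> (A_t, B_t, h_t) lying
in the variety: a polynomial function which is nonzero for one t is nonzero
for all but finitely many t, and ranks of matrices can only go up for generic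
t (generic_rank).

The plan is to move every point into the locus where A and B are both thin,
that is, where at most one Jordan block of each has size smaller than m
([thin]).  For given dimension, the thin nilpotent matrices form one conjugacy
class (thin_rank, conj_of_rank), and homomorphisms between two fixed modules
form a vector space, so any two points of the thin locus are joined by a curve
built from the adjugates of two matrices interpolating between the identity
and the conjugating matrices (join_conjugate).

To reach the thin locus, suppose that A, say, has two blocks of sizes p >= q
with p < m.  One looks for a curve along which these become blocks of sizes
p+1 and q-1, so that the rank of A^p grows; since the sum of the ranks of all
powers of A and B is bounded, this can happen only finitely often
(thin_dense).  The curves are perturbations of rank one, A_t = A + t phi u.
There are two kinds.

- If u h = eta B^r for a suitable r between q and p, then B can stay fixed and
  h is corrected to first order only (move_source).
- If both A and B have blocks of sizes p and q, then A and B are deformed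
  simultaneously and h stays fixed (move_both).

Beforehand h may be replaced by a generic homomorphism, and this makes one of
the two moves available (source_improvable): choose among all pairs of blocks
of size smaller than m, of A or of B, one with p - q minimal; by transposition
it belongs to A.  Minimality forbids two blocks of B with sizes between q and p,
unless these sizes are exactly q and p, when move_both applies.  So B has at
most one block of a size r between q and p, and then some combination of
elements of the two chains of A is mapped into the row space of B^r, which is
what move_source asks for. *)

(** * Polynomial curves and generic parameters *)

Section PolynomialCurves.

Variable K : closedFieldType.
Implicit Types (F G : K -> K).

Definition polyfun F := exists p : {poly K}, forall t, F t = p.[t].

Definition polymx m n (A : K -> 'M[K]_(m, n)) := forall i j, polyfun (fun t => A t i j).

Lemma polyfun_ext F G : F =1 G -> polyfun F -> polyfun G.
Proof. by move=> FG [p Fp]; exists p => t; rewrite -FG. Qed.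

Lemma polyfun_const c : polyfun (fun=> c).
Proof. by exists c%:P => t; rewrite hornerC. Qed.

Lemma polyfun_id : polyfun id.
Proof. by exists 'X => t; rewrite hornerX. Qed.

Lemma polyfunD F G : polyfun F -> polyfun G -> polyfun (fun t => F t + G t).
Proof. by move=> [p Fp] [q Gq]; exists (p + q) => t; rewrite hornerD Fp Gq. Qed.

Lemma polyfunM F G : polyfun F -> polyfun G -> polyfun (fun t => F t * G t).
Proof. by move=> [p Fp] [q Gq]; exists (p * q) => t; rewrite hornerM Fp Gq. Qed.

Lemma polyfun_sum (I : Type) (r : seq I) (P : pred I) (F : I -> K -> K) :
  (forall i, polyfun (F i)) -> polyfun (fun t => \sum_(i <- r | P i) F i t).
Proof.
move=> PF; elim: r => [|i r IHr].
  by apply: polyfun_ext (polyfun_const 0) => t; rewrite big_nil.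
case Pi: (P i); last by apply: polyfun_ext IHr => t; rewrite big_cons Pi.
by apply: polyfun_ext (polyfunD (PF i) IHr) => t; rewrite big_cons Pi.
Qed.

Lemma polyfun_prod (I : Type) (r : seq I) (P : pred I) (F : I -> K -> K) :
  (forall i, polyfun (F i)) -> polyfun (fun t => \prod_(i <- r | P i) F i t).
Proof.
move=> PF; elim: r => [|i r IHr].
  by apply: polyfun_ext (polyfun_const 1) => t; rewrite big_nil.
case Pi: (P i); last by apply: polyfun_ext IHr => t; rewrite big_cons Pi.
by apply: polyfun_ext (polyfunM (PF i) IHr) => t; rewrite big_cons Pi.
Qed.

Lemma polyfunX F n : polyfun F -> polyfun (fun t => F t ^+ n).
Proof. by move=> [p Fp]; exists (p ^+ n) => t; rewrite horner_exp Fp. Qed.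

Lemma polyfun_meval n (p : {mpoly K[n]}) (v : K -> 'I_n -> K) :
  (forall i, polyfun (fun t => v t i)) -> polyfun (fun t => p.@[v t]).
Proof.
move=> Pv; apply: (@polyfun_ext (fun t =>
  \sum_(m <- msupp p) p@_m * \prod_i v t i ^+ m i)) => [t|].
  by rewrite mevalE.
apply: polyfun_sum => m; apply: polyfunM; first exact: polyfun_const.
by apply: polyfun_prod => i; apply: polyfunX.
Qed.

Lemma polymx_const m n (A : 'M[K]_(m, n)) : polymx (fun=> A).
Proof. by move=> i j; apply: polyfun_const. Qed.

Lemma polymxD m n (A B : K -> 'M[K]_(m, n)) :
  polymx A -> polymx B -> polymx (fun t => A t + B t).
Proof.
move=> PA PB i j; apply: polyfun_ext (polyfunD (PA i j) (PB i j)) => t.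
by rewrite mxE.
Qed.

Lemma polymxZ m n F (A : K -> 'M[K]_(m, n)) :
  polyfun F -> polymx A -> polymx (fun t => F t *: A t).
Proof.
move=> PF PA i j; apply: polyfun_ext (polyfunM PF (PA i j)) => t.
by rewrite mxE.
Qed.

Lemma polymxM m n p (A : K -> 'M[K]_(m, n)) (B : K -> 'M[K]_(n, p)) :
  polymx A -> polymx B -> polymx (fun t => A t *m B t).
Proof.
move=> PA PB i j.
apply: (@polyfun_ext (fun t => \sum_k A t i k * B t k j)) => [t|].
  by rewrite mxE.
by apply: polyfun_sum => k; apply: polyfunM.
Qed.

Lemma polymx_tr m n (A : K -> 'M[K]_(m, n)) :
  polymx A -> polymx (fun t => (A t)^T).
Proof. by move=> PA i j; apply: polyfun_ext (PA j i) => t; rewrite mxE. Qed.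

Lemma polymxX n (A : K -> 'M[K]_n) k : polymx A -> polymx (fun t => A t ^+ k).
Proof.
move=> PA; elim: k => [|k IHk]; first exact: polymx_const.
move=> i j; apply: polyfun_ext (polymxM PA IHk i j) => t.
by rewrite exprS.
Qed.

Lemma polyfun_det n (A : K -> 'M[K]_n) :
  polymx A -> polyfun (fun t => \det (A t)).
Proof.
move=> PA; apply: polyfun_sum => s.
apply: polyfunM; first exact: polyfun_const.
by apply: polyfun_prod => i; apply: PA.
Qed.

Lemma polymx_adj n (A : K -> 'M[K]_n) : polymx A -> polymx (fun t => \adj (A t)).
Proof.
move=> PA i j; apply: (@polyfun_ext (fun t => cofactor (A t) j i)) => [t|].
  by rewrite mxE.
apply: polyfunM; first exact: polyfun_const.
apply: polyfun_det => k l.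
by apply: polyfun_ext (PA (lift j k) (lift i l)) => t; rewrite !mxE.
Qed.

Lemma polymx_line m n (A B : 'M[K]_(m, n)) : polymx (fun t => A + t *: B).
Proof.
apply: polymxD; first exact: polymx_const.
by apply: polymxZ; [exact: polyfun_id | exact: polymx_const].
Qed.

(** Nonvanishing of one nonzero polynomial, rather than cofiniteness, because it
gives closure under conjunction directly: the product of two nonzero
polynomials over an infinite field has a nonroot. *)
Definition generic (P : K -> Prop) :=
  exists F, [/\ polyfun F, exists a, F a != 0 & forall t, F t != 0 -> P t].

Lemma generic_polyfun F a : polyfun F -> F a != 0 -> generic (fun t => F t != 0).
Proof. by move=> PF Fa; exists F; split=> //; exists a. Qed.

Lemma generic_neq a : generic (fun t => t != a).
Proof.
exists (fun t => t + - a); split.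
- exact: polyfunD polyfun_id (polyfun_const _).
- by exists (a + 1); rewrite addrAC subrr add0r oner_neq0.
- by move=> t; rewrite subr_eq0.
Qed.

Lemma generic_impl (P Q : K -> Prop) :
  (forall t, P t -> Q t) -> generic P -> generic Q.
Proof. by move=> PQ [F [PF aF FP]]; exists F; split=> // t /FP/PQ. Qed.

Lemma generic_ex (P : K -> Prop) : generic P -> exists t, P t.
Proof. by case=> F [_ [a Fa] FP]; exists a; apply: FP. Qed.

Lemma generic_and (P Q : K -> Prop) :
  generic P -> generic Q -> generic (fun t => P t /\ Q t).
Proof.
move=> [F [[p Fp] [a Fa] FP]] [G [[q Gq] [b Gb] GQ]].
have p0 : p != 0 by apply: contraNneq Fa => p0; rewrite Fp p0 horner0.
have q0 : q != 0 by apply: contraNneq Gb => q0; rewrite Gq q0 horner0.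
exists (fun t => F t * G t); split.
- by exists (p * q) => t; rewrite hornerM Fp Gq.
- have /closed_nonrootP[t] : p * q != 0 by rewrite mulf_neq0.
  by rewrite /root hornerM -Fp -Gq; exists t.
- by move=> t; rewrite mulf_eq0 negb_or => /andP[/FP Pt /GQ Qt].
Qed.

Lemma generic_all n (P : nat -> K -> Prop) :
  (forall k, (k < n)%N -> generic (P k)) ->
  generic (fun t => forall k, (k < n)%N -> P k t).
Proof.
elim: n => [_|n IHn Pn].
  by apply: generic_impl (generic_neq 0) => t _ k.
apply: generic_impl (generic_and (IHn _) (Pn n _)) => [t [Pt Pnt] k|k ltkn|] //.
  by rewrite ltnS leq_eqVlt => /predU1P[-> //|]; apply: Pt.
by apply: Pn; apply: ltnW.
Qed.

(** With rho the rank at a, choose constant L and R such that L A(a) R is the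
identity matrix of size rho; its determinant stays nonzero for generic t. *)
Lemma generic_rank m n (A : K -> 'M[K]_(m, n)) a :
  polymx A -> generic (fun t => (\rank (A a) <= \rank (A t))%N).
Proof.
move=> PA; pose L := row_base (A a) *m pinvmx (A a).
have LA : L *m A a = row_base (A a) by rewrite mulmxKpV // eq_row_base.
pose D t := L *m A t *m pinvmx (row_base (A a)).
have Da : D a = 1%:M by rewrite /D LA mulmxVp // row_base_free.
have PD : polymx D by do 2!apply: polymxM => //; exact: polymx_const.
have Da0 : \det (D a) != 0 by rewrite Da det1 oner_neq0.
apply: generic_impl (generic_polyfun (polyfun_det PD) Da0) => t Dt.
have : D t \in unitmx by rewrite unitmxE unitfE.
rewrite -row_full_unit => /eqP <-.
exact: leq_trans (mxrankM_maxl _ _) (mxrankM_maxr _ _).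
Qed.

End PolynomialCurves.

(** * Row spaces, rank-one perturbations and chain homomorphisms *)

Section RowSpaces.

Variable K : fieldType.

(** The vector z shows that b lies in the row space of B + ab, which therefore
contains the row space of B, and b besides. *)
Lemma rank_gain m n (B : 'M[K]_(m, n)) (a : 'cV_m) (b : 'rV_n) (z : 'rV_m) :
    z *m B = 0 -> z *m a != 0 -> ~~ (b <= B)%MS ->
  (\rank B < \rank (B + a *m b)%R)%N.
Proof.
move=> zB za bB; set C := B + a *m b.
have zC : z *m C = (z *m a) 0 0 *: b.
  by rewrite mulmxDr zB add0r mulmxA [z *m a]mx11_scalar mul_scalar_mx !mxE eqxx.
have za0 : (z *m a) 0 0 != 0.
  by apply: contraNneq za => za0; rewrite [z *m a]mx11_scalar za0 raddf0.
have bC : (b <= C)%MS by have := submxMl z C; rewrite zC (eqmx_scale _ za0).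
have BbC : (B + b <= C)%MS.
  rewrite addsmx_sub bC andbT -[B](addrK (a *m b)).
  by rewrite addmx_sub // eqmx_opp (submx_trans (submxMl _ _)).
apply: leq_trans (mxrankS BbC); rewrite ltn_neqAle mxrankS ?addsmxSl // andbT.
apply: contra bB => /eqP eqr; apply: submx_trans (addsmxSr B b) _.
by rewrite -(geq_leqif (mxrank_leqif_sup (addsmxSl B b))) eqr.
Qed.

Lemma separating_functional m n (S : 'M[K]_(m, n)) (w : 'rV_n) :
  ~~ (w <= S)%MS -> exists phi : 'cV_n, S *m phi = 0 /\ w *m phi = 1%:M.
Proof.
rewrite submxE; have := mulmx_coker S; move: (cokermx S) => C SC.
case/rV0Pn=> j wj; exists (((w *m C) 0 j)^-1 *: col j C); split.
  by rewrite -scalemxAr colE mulmxA SC mul0mx scaler0.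
rewrite -scalemxAr colE mulmxA -colE [col _ _]mx11_scalar scale_scalar_mx.
by rewrite [col _ _ _ _]mxE mulVf.
Qed.

Lemma row_in_sumP m n (S : 'M[K]_(m, n)) (x u : 'rV_n) :
  (x <= S + u)%MS -> exists a c, x = a *m S + c *: u.
Proof.
case/sub_addsmxP=> -[a c] /= ->; exists a, (c 0 0).
by rewrite {1}[c]mx11_scalar mul_scalar_mx.
Qed.

Lemma separating_functional2 m n (S : 'M[K]_(m, n)) (u w : 'rV_n) :
    ~~ (w <= S + u)%MS ->
  exists phi : 'cV_n, [/\ S *m phi = 0, u *m phi = 0 & w *m phi = 1%:M].
Proof.
case/separating_functional=> phi [Sphi wphi]; exists phi; split=> //.
  by have /submxP[D ->] := addsmxSl S u; rewrite -mulmxA Sphi mulmx0.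
by have /submxP[D ->] := addsmxSr S u; rewrite -mulmxA Sphi mulmx0.
Qed.

Variable d : nat.
Implicit Types (A : 'M[K]_d).

Lemma mxX_S A k : A ^+ k.+1 = A *m A ^+ k. Proof. by rewrite exprS. Qed.
Lemma mxX_Sr A k : A ^+ k.+1 = A ^+ k *m A. Proof. by rewrite exprSr. Qed.
Lemma mxX_D A k l : A ^+ (k + l) = A ^+ k *m A ^+ l. Proof. by rewrite exprD. Qed.

Lemma mxX_vanish n A k l (x : 'M_(n, d)) :
  (k <= l)%N -> x *m A ^+ k = 0 -> x *m A ^+ l = 0.
Proof. by move=> kl x0; rewrite -(subnKC kl) mxX_D mulmxA x0 mul0mx. Qed.

Lemma mxX_vanishl n A k l (x : 'M_(d, n)) :
  (k <= l)%N -> A ^+ k *m x = 0 -> A ^+ l *m x = 0.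
Proof. by move=> kl x0; rewrite -(subnK kl) mxX_D -mulmxA x0 mulmx0. Qed.

Lemma mxX_sub A k l : (k <= l)%N -> (A ^+ l <= A ^+ k)%MS.
Proof. by move=> kl; rewrite -(subnK kl) mxX_D submxMl. Qed.

Lemma nilp_le A k l : (k <= l)%N -> A ^+ k = 0 -> A ^+ l = 0.
Proof. by move=> kl A0; rewrite -(subnK kl) mxX_D A0 mulmx0. Qed.

Lemma trmxX A k : (A ^+ k)^T = A^T ^+ k.
Proof.
elim: k => [|k IHk]; first by rewrite !expr0 trmx1.
by rewrite mxX_S trmx_mul IHk -mxX_Sr.
Qed.

(** The hypothesis kills every product in which phi u occurs twice, so the power
is exactly its first-order expansion. *)
Lemma expr_rank1 A (phi : 'cV_d) (u : 'rV_d) n :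
    (forall k, u *m A ^+ k *m phi = 0) ->
  (A + phi *m u) ^+ n =
    A ^+ n + \sum_(k < n) A ^+ (n.-1 - k) *m phi *m u *m A ^+ k.
Proof.
move=> uphi; elim: n => [|n IHn]; first by rewrite big_ord0 addr0.
rewrite mxX_Sr IHn mulmxDr !mulmxDl -mxX_Sr big_ord_recl subn0 /= -addrA.
congr (_ + _); rewrite addrC expr0 mulmx1 mulmxA -addrA; congr (_ + _).
rewrite !mulmx_suml [X in X + _]big1 ?add0r => [|k _]; last first.
  by rewrite -!mulmxA (mulmxA (A ^+ k)) !(mulmxA u) uphi mul0mx !mulmx0.
apply: eq_bigr => k _; rewrite -mulmxA -mxX_Sr /bump add1n.
by do 3!congr (_ *m _); congr (_ ^+ _); have := ltn_ord k; lia.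
Qed.

Lemma expr_rank1_vanish A (phi : 'cV_d) (u : 'rV_d) r s n :
    (forall k, u *m A ^+ k *m phi = 0) ->
    A ^+ r *m phi = 0 -> u *m A ^+ s = 0 -> (r + s <= n)%N ->
  (A + phi *m u) ^+ n = A ^+ n.
Proof.
move=> uphi Aphi uA rsn; rewrite expr_rank1 // big1 ?addr0 // => k _.
have [sk|ks] := leqP s k.
  by rewrite -mulmxA (mxX_vanish sk) ?mulmx0.
by rewrite (@mxX_vanishl _ A r) ?mul0mx //; lia.
Qed.

End RowSpaces.

Section RankOneHom.

Variables (K : fieldType) (d0 d1 : nat) (A : 'M[K]_d0) (B : 'M[K]_d1).

Lemma intertwineX h k : A *m h = h *m B -> A ^+ k *m h = h *m B ^+ k.
Proof.
move=> AhB; elim: k => [|k IHk]; first by rewrite !expr0 mul1mx mulmx1.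
by rewrite mxX_S -mulmxA IHk mulmxA AhB -mulmxA -mxX_S.
Qed.

(** The candidate homomorphism sending x to sum_k (x A^(n-k) phi) g B^k: if g is
killed by B^(n+1), this is the map which reads the coefficients of x along a
Jordan chain of length n+1, and reproduces them along the chain of g. *)
Definition chain_hom n (phi : 'cV[K]_d0) (g : 'rV[K]_d1) :=
  \sum_(k < n.+1) A ^+ (n - k) *m phi *m g *m B ^+ k.

(** Both products are sums of the same terms T 0, ..., T (n+1), shifted by one. *)
Lemma chain_hom_comm n phi g :
  A *m chain_hom n phi g + phi *m g *m B ^+ n.+1 =
    A ^+ n.+1 *m phi *m g + chain_hom n phi g *m B.
Proof.
pose T k := A ^+ (n.+1 - k) *m phi *m g *m B ^+ k.
have -> : A *m chain_hom n phi g = \sum_(k < n.+1) T k.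
  rewrite mulmx_sumr; apply: eq_bigr => k _.
  by rewrite /T (subSn (ltn_ord k : (k <= n)%N)) mxX_S !mulmxA.
have -> : chain_hom n phi g *m B = \sum_(k < n.+1) T k.+1.
  rewrite mulmx_suml; apply: eq_bigr => k _.
  by rewrite /T subSS -mulmxA -mxX_Sr.
have -> : phi *m g *m B ^+ n.+1 = T n.+1 by rewrite /T subnn expr0 mul1mx.
have -> : A ^+ n.+1 *m phi *m g = T 0%N by rewrite /T subn0 expr0 mulmx1.
by rewrite -(big_ord_recr n.+1 T) big_ord_recl.
Qed.

Lemma chain_hom_intertwines n phi g :
    A ^+ n.+1 *m phi = 0 -> g *m B ^+ n.+1 = 0 ->
  A *m chain_hom n phi g = chain_hom n phi g *m B.
Proof.
move=> Aphi gB; have := chain_hom_comm n phi g.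
by rewrite Aphi mul0mx add0r -[phi *m g *m _]mulmxA gB mulmx0 addr0.
Qed.

(** Of the terms of the sum, those with index below r vanish on e, those above r
on g. *)
Lemma chain_hom_eval n r phi g (e : 'rV_d0) :
    (r <= n)%N -> e *m A ^+ n.+1 = 0 -> g *m B ^+ r.+1 = 0 ->
  e *m A ^+ r *m chain_hom n phi g = e *m A ^+ n *m phi *m g *m B ^+ r.
Proof.
move=> rn eA gB; have ltrn : (r < n.+1)%N by rewrite ltnS.
rewrite mulmx_sumr (bigD1 (Ordinal ltrn)) //= big1 ?addr0 => [|k].
  by rewrite !mulmxA -(mulmxA e) -mxX_D subnKC.
rewrite -val_eqE neq_ltn /= => /orP[kr|rk].
  rewrite !mulmxA -(mulmxA e) -mxX_D (mxX_vanish _ eA) ?mul0mx //.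
  by have := ltn_ord k; lia.
by rewrite -!(mulmxA _ g) (mxX_vanish rk gB) !mulmx0.
Qed.

Lemma chain_hom_vanish n phi g (u : 'rV_d0) :
  (forall k, u *m A ^+ k *m phi = 0) -> u *m chain_hom n phi g = 0.
Proof.
by move=> uphi; rewrite mulmx_sumr big1 // => k _; rewrite !mulmxA uphi !mul0mx.
Qed.

End RankOneHom.

(** * Two deformations that increase the rank of a power *)

Section Moves.

Variables (K : closedFieldType) (m d0 d1 : nat).
Implicit Types (A : 'M[K]_d0) (B : 'M[K]_d1) (h : 'M[K]_(d0, d1)).

Definition nilp_triple A B h := [/\ A ^+ m = 0, B ^+ m = 0 & A *m h = h *m B].

(** The only property of polynomial functions of the entries that matters: they
restrict to polynomials along polynomial curves.  Put in this form it is
obviously stable under transposition of triples. *)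
Definition regular (F : 'M[K]_d0 -> 'M[K]_d1 -> 'M[K]_(d0, d1) -> K) :=
  forall At Bt ht, polymx At -> polymx Bt -> polymx ht ->
    polyfun (fun t => F (At t) (Bt t) (ht t)).

Definition total_rank A B := (\sum_(k < m) (\rank (A ^+ k) + \rank (B ^+ k)))%N.

Lemma total_rank_le A B : (total_rank A B <= m * (d0 + d1))%N.
Proof.
rewrite -[m in (m * _)%N]card_ord -sum_nat_const; apply: leq_sum => k _.
by rewrite leq_add // rank_leq_row.
Qed.

Variable F : 'M[K]_d0 -> 'M[K]_d1 -> 'M[K]_(d0, d1) -> K.
Hypothesis regF : regular F.

Definition improvable A B :=
  exists A' B' h', [/\ nilp_triple A' B' h', F A' B' h' != 0
                     & (total_rank A B < total_rank A' B')%N].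

Lemma curve_improves (At : K -> 'M[K]_d0) (Bt : K -> 'M[K]_d1) ht k A B h :
    [/\ polymx At, polymx Bt & polymx ht] ->
    [/\ At 0 = A, Bt 0 = B & ht 0 = h] ->
    (forall t, nilp_triple (At t) (Bt t) (ht t)) -> F A B h != 0 ->
    (k < m)%N -> (forall t, t != 0 -> (\rank (A ^+ k) < \rank (At t ^+ k))%N) ->
  improvable A B.
Proof.
move=> [PA PB Ph] [A0 B0 h0] Xt FABh km gain.
have FP : generic (fun t => F (At t) (Bt t) (ht t) != 0).
  by apply: (@generic_polyfun _ _ 0); [apply: regF | rewrite A0 B0 h0].
have AP : generic (fun t => forall j, (j < m)%N ->
    (\rank (A ^+ j) <= \rank (At t ^+ j))%N).
  by apply: generic_all => j _; rewrite -A0; apply/generic_rank/polymxX.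
have BP : generic (fun t => forall j, (j < m)%N ->
    (\rank (B ^+ j) <= \rank (Bt t ^+ j))%N).
  by apply: generic_all => j _; rewrite -B0; apply/generic_rank/polymxX.
have [t [Ft [leA [leB /gain gain_k]]]] :=
  generic_ex (generic_and FP (generic_and AP (generic_and BP (generic_neq 0)))).
exists (At t), (Bt t), (ht t); split=> //.
rewrite /total_rank (bigD1 (Ordinal km)) //= [X in (_ < X)%N](bigD1 (Ordinal km)) //=.
rewrite -addSn; apply: leq_add.
  by rewrite -addSn; apply: leq_add; rewrite ?leB.
by apply: leq_sum => j _; rewrite leq_add ?leA ?leB.
Qed.

(** Homomorphisms form a vector space, so h can be moved along the line
h + t h1, on which v h is outside S for generic t if v h1 is. *)
Lemma adjust_hom A B h h1 (v : 'rV_d0) n (S : 'M_(n, d1)) :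
    nilp_triple A B h -> F A B h != 0 -> A *m h1 = h1 *m B -> ~~ (v *m h1 <= S)%MS ->
  exists t, [/\ nilp_triple A B (h + t *: h1), F A B (h + t *: h1) != 0
              & ~~ (v *m (h + t *: h1) <= S)%MS].
Proof.
move=> [Am Bm AhB] FABh Ah1B vh1.
have Xt t : nilp_triple A B (h + t *: h1).
  by split=> //; rewrite mulmxDr mulmxDl -scalemxAr -scalemxAl AhB Ah1B.
have [vhS|vhS] := boolP (v *m h <= S)%MS; last first.
  by exists 0; split; rewrite ?scale0r ?addr0.
have FP : generic (fun t => F A B (h + t *: h1) != 0).
  apply: (@generic_polyfun _ _ 0); last by rewrite scale0r addr0.
  by apply: regF; [exact: polymx_const | exact: polymx_const | exact: polymx_line].
have [t [Ft t0]] := generic_ex (generic_and FP (generic_neq 0)).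
exists t; split=> //; apply: contra vh1 => vht.
rewrite -(eqmx_scale _ t0) scalemxAr -[_ *m _](addKr (v *m h)) -mulmxDr.
by rewrite addmx_sub // eqmx_opp.
Qed.

(** The deformation A + t phi u, where phi vanishes on u and on A^(r+1) and
takes the value 1 at e A^r.  It sends e A^r to e A^(r+1) + t u, so that the
homomorphism h must be changed by t H with A H - H B = - phi u h; since
u h = eta B^(r+1), this is solved by the chain homomorphism H of phi and eta,
and H vanishes on u, so that there is no second-order error.

The example to keep in mind has e and f generating Jordan blocks of sizes
p+1 >= q+1, and u = f A^q - e A^r for some r between q and p; the blocks become
one of size p+2 and one of size q. *)
Lemma move_source A B h p r (u e : 'rV_d0) (eta : 'rV_d1) :
    nilp_triple A B h -> F A B h != 0 -> (r <= p)%N -> (p.+1 < m)%N ->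
    u *m A ^+ (p - r).+1 = 0 -> (u *m A <= A ^+ r.+1)%MS ->
    u *m h = eta *m B ^+ r.+1 ->
    ~~ (u *m A ^+ (p - r) <= A ^+ p.+1)%MS ->
    e *m A ^+ p.+1 = 0 -> ~~ (e *m A ^+ r <= A ^+ r.+1 + u)%MS ->
  improvable A B.
Proof.
move=> [Am Bm AhB] FABh rp pm uA uAr uh uAp eA eAr.
have [phi [Aphi uphi ephi]] := separating_functional2 eAr.
have uAphi k : u *m A ^+ k *m phi = 0.
  case: k => [|k]; first by rewrite expr0 mulmx1.
  have /submxP[D uAD] := uAr.
  rewrite mxX_S mulmxA uAD -(mulmxA D) -mxX_D addnC mxX_D !mulmxA.
  by rewrite -(mulmxA _ _ phi) Aphi mulmx0.
pose H := chain_hom A B r phi eta.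
have uH : u *m H = 0 by apply: chain_hom_vanish.
pose At t := A + (t *: phi) *m u.
have Atu t k : u *m A ^+ k *m (t *: phi) = 0 by rewrite -scalemxAr uAphi scaler0.
(* among the first-order terms, A^(p-k) phi u A^k survives only for k = p - r *)
have AtX t : At t ^+ p.+1 = A ^+ p.+1 + (t *: (A ^+ r *m phi)) *m (u *m A ^+ (p - r)).
  rewrite expr_rank1 //; congr (_ + _).
  have ltk : (p - r < p.+1)%N by rewrite ltnS leq_subr.
  rewrite (bigD1 (Ordinal ltk)) //= big1 ?addr0 => [|k].
    by rewrite subKn // mulmxA scalemxAr.
  rewrite -val_eqE neq_ltn /= => /orP[kr|rk]; last first.
    by rewrite -mulmxA (mxX_vanish rk) ?mulmx0.
  rewrite -scalemxAr (mxX_vanishl _ Aphi) ?scaler0 ?mul0mx //.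
  by move: kr; lia.
apply: (@curve_improves At (fun=> B) (fun t => h + t *: H) p.+1 A B h) => //.
- split; [|exact: polymx_const|exact: polymx_line].
  apply: polymxD; first exact: polymx_const.
  apply: polymxM; last exact: polymx_const.
  by apply: polymxZ; [exact: polyfun_id | exact: polymx_const].
- by rewrite /At !scale0r mul0mx !addr0.
- move=> t; split=> //.
    rewrite (expr_rank1_vanish (r := r.+1) (s := (p - r).+1)) //; last by lia.
    by rewrite -scalemxAr Aphi scaler0.
  have AH : A *m H + phi *m (u *m h) = H *m B.
    by rewrite uh mulmxA chain_hom_comm Aphi mul0mx add0r.
  rewrite mulmxDr !mulmxDl AhB -!scalemxAr -!mulmxA uH mulmx0 scaler0 addr0.
  by rewrite -!scalemxAl -AH scalerDr -addrA [t *: (_ *m (u *m h)) + _]addrC.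
- move=> t t0; rewrite AtX; apply: (rank_gain (z := e)) => //.
  by rewrite -scalemxAr mulmxA ephi scaler_eq0 negb_or t0 oner_neq0.
Qed.

(** Here u is in the socle and A and B are perturbed by phi0 u and phi (u h) with
phi0 = h phi.  Both perturbations become h phi u h when multiplied by h on the
appropriate side, so h remains a homomorphism. *)
Lemma move_both A B h p (u e : 'rV_d0) :
    nilp_triple A B h -> F A B h != 0 -> (p.+1 < m)%N ->
    u *m A = 0 -> ~~ (u <= A ^+ p.+1)%MS -> e *m A ^+ p.+1 = 0 ->
    ~~ (e *m A ^+ p *m h <= B ^+ p.+1 + u *m h)%MS ->
  improvable A B.
Proof.
move=> [Am Bm AhB] FABh pm uA uAp eA ehB.
have [phi [Bphi uphi ephi]] := separating_functional2 ehB.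
have uhB : u *m h *m B = 0 by rewrite -mulmxA -AhB mulmxA uA mul0mx.
have Ahphi : A ^+ p.+1 *m (h *m phi) = 0.
  by rewrite mulmxA (intertwineX _ AhB) -mulmxA Bphi mulmx0.
pose At t := A + (t *: (h *m phi)) *m u.
pose Bt t := B + (t *: phi) *m (u *m h).
have Atu t k : u *m A ^+ k *m (t *: (h *m phi)) = 0.
  case: k => [|k]; first by rewrite expr0 mulmx1 -scalemxAr mulmxA uphi scaler0.
  by rewrite mxX_S mulmxA uA !mul0mx.
have Btu t k : u *m h *m B ^+ k *m (t *: phi) = 0.
  case: k => [|k]; first by rewrite expr0 mulmx1 -scalemxAr uphi scaler0.
  by rewrite mxX_S mulmxA uhB !mul0mx.
have AtX t : At t ^+ p.+1 = A ^+ p.+1 + (t *: (A ^+ p *m (h *m phi))) *m u.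
  rewrite expr_rank1 // big_ord_recl big1 ?addr0 => [|k _].
    by rewrite /= subn0 expr0 mulmx1 -scalemxAr.
  by rewrite -mulmxA mxX_S (mulmxA u) uA mul0mx mulmx0.
apply: (@curve_improves At Bt (fun=> h) p.+1 A B h) => //.
- split; [| |exact: polymx_const];
    (apply: polymxD; first exact: polymx_const);
    (apply: polymxM; last exact: polymx_const);
    by apply: polymxZ; [exact: polyfun_id | exact: polymx_const].
- by rewrite /At /Bt !scale0r !mul0mx !addr0.
- move=> t; split.
  + rewrite (expr_rank1_vanish (r := p.+1) (s := 1)) ?addn1 //.
    by rewrite -scalemxAr Ahphi scaler0.
  + rewrite (expr_rank1_vanish (r := p.+1) (s := 1)) ?addn1 //.
    by rewrite -scalemxAr Bphi scaler0.
  + by rewrite /At /Bt mulmxDl mulmxDr AhB -!scalemxAl -scalemxAr !mulmxA.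
- move=> t t0; rewrite AtX; apply: (rank_gain (z := e)) => //.
  by rewrite -scalemxAr !mulmxA ephi scaler_eq0 negb_or t0 oner_neq0.
Qed.

End Moves.

(** * Jordan blocks in terms of row spaces *)

Section Blocks.

Variables (K : fieldType) (d : nat).
Implicit Types (A : 'M[K]_d).

(** A Jordan block of size k+1, not k: there is a chain of that length, generated
by f, whose last element does not end a longer chain. *)
Definition block A k :=
  exists2 f : 'rV_d, f *m A ^+ k.+1 = 0 & ~~ (f *m A ^+ k <= A ^+ k.+1)%MS.

(** Jordan blocks of sizes p+1 and q+1, where p >= q.  For p = q the last
condition says that there are at least two blocks of that size; for p > q it
adds nothing to the existence of one block of each size (two_blocks_lt). *)
Definition two_blocks A p q :=
  exists e f : 'rV_d,
    [/\ e *m A ^+ p.+1 = 0, f *m A ^+ q.+1 = 0, ~~ (f *m A ^+ q <= A ^+ q.+1)%MS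
      & ~~ (e *m A ^+ p <= A ^+ p.+1 + f *m A ^+ q)%MS].

Lemma two_blocks_lt A p q :
  (q < p)%N -> block A p -> block A q -> two_blocks A p q.
Proof.
move=> qp [e eA eAp] [f fA fAq]; exists e, f; split=> //.
apply/negP=> /row_in_sumP[a [c eAE]].
have [c0|c0] := eqVneq c 0.
  by case/negP: eAp; rewrite eAE c0 scale0r addr0 submxMl.
case/negP: fAq; rewrite -(eqmx_scale _ c0) -[_ *: _](addKr (a *m A ^+ p.+1)) -eAE.
apply: submx_trans (mxX_sub A qp); rewrite addmx_sub ?submxMl // eqmx_opp.
by rewrite (submx_trans (submxMl _ _)) // mxX_sub.
Qed.

(** The functionals which separate the ends of the two chains generate chains
for the transpose; the roles are dual, so e and f certify their independence. *)
Lemma two_blocks_tr A p q : (q <= p)%N -> two_blocks A p q -> two_blocks A^T p q.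
Proof.
move=> qp [e [f [eA fA fAq eAp]]].
have [phi [Aphi fphi ephi]] := separating_functional2 eAp.
have [psi [Apsi fpsi]] := separating_functional fAq.
have one0 : 1%:M != 0 :> 'M[K]_1 by rewrite oner_neq0.
have fAphi : f *m A ^+ p *m phi = 0.
  move: qp; rewrite leq_eqVlt => /predU1P[<- //|qp].
  by rewrite (mxX_vanish qp fA) mul0mx.
exists phi^T, psi^T; rewrite -!trmxX -!trmx_mul Aphi Apsi !trmx0; split=> //.
  apply/negP=> /submxP[D /(congr1 trmx)]; rewrite trmxK trmx_mul trmxK => psiE.
  case/eqP: one0; rewrite -fpsi -mulmxA psiE mulmxA fA mul0mx //.
apply/negP=> /row_in_sumP[D [c /(congr1 trmx)]].
rewrite linearD linearZ /= !trmxK trmx_mul trmxK => phiE.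
have c0 : c = 0.
  have /eqP : f *m A ^+ p *m phi = c *: 1%:M.
    rewrite -mulmxA phiE mulmxDr mulmxA (mxX_vanish _ fA) // mul0mx add0r.
    by rewrite -scalemxAr mulmxA fpsi.
  by rewrite fAphi eq_sym scaler_eq0 (negPf one0) orbF => /eqP.
case/eqP: one0.
by rewrite -ephi -mulmxA phiE c0 scale0r addr0 mulmxA eA mul0mx.
Qed.

(** The end of a chain of length k+1 ends a longer chain as long as there is no
block of the size at hand. *)
Lemma climb A k l (z : 'rV_d) :
    (k <= l)%N -> (forall j, (k <= j < l)%N -> ~ block A j) ->
    z *m A ^+ k.+1 = 0 ->
  exists z' : 'rV_d, z *m A ^+ k = z' *m A ^+ l.
Proof.
move=> kl; rewrite -(subnKC kl); elim: (l - k)%N => [|n IHn] noblock zA.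
  by exists z; rewrite addn0.
have [j /andP[kj jn]|z' zE] := IHn _ zA.
  by apply: noblock; rewrite kj addnS ltnS ltnW.
rewrite addnS; apply/submxP; rewrite zE; apply/negPn/negP => znot.
case: (noblock (k + n)%N); first by rewrite leq_addr addnS leqnn.
by exists z' => //; rewrite mxX_Sr mulmxA -zE -mulmxA -mxX_Sr.
Qed.

(** By induction on p: if p > r, there is no block of size p+1, so y A^p = z A^(p+1)
for some z, and y may be replaced by y - z A, which A^p kills; this changes
y A^r by an element of the row space of A^(r+1). *)
Lemma descend A r p (g y : 'rV_d) :
    (r <= p)%N -> (forall j, (r < j <= p)%N -> ~ block A j) ->
    (forall z : 'rV_d, z *m A ^+ r.+1 = 0 ->
       (z *m A ^+ r <= A ^+ r.+1 + g *m A ^+ r)%MS) ->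
    y *m A ^+ p.+1 = 0 ->
  (y *m A ^+ r <= A ^+ r.+1 + g *m A ^+ r)%MS.
Proof.
move=> rp; rewrite -(subnKC rp); elim: (p - r)%N y => [|n IHn] y noblock uniq_r yA.
  by apply: uniq_r; rewrite addn0 in yA.
rewrite addnS in yA.
have /submxP[z zE] : (y *m A ^+ (r + n).+1 <= A ^+ (r + n).+2)%MS.
  apply/negPn/negP=> ynot; apply: (noblock (r + n).+1); last by exists y.
  by rewrite addnS ltnS leq_addr leqnn.
have -> : y *m A ^+ r = (y - z *m A) *m A ^+ r + z *m A ^+ r.+1.
  by rewrite mulmxBl mxX_S mulmxA subrK.
apply: addmx_sub; last by rewrite (submx_trans (submxMl _ _)) // addsmxSl.
apply: IHn => //.
  by move=> j /andP[rj jn]; apply: noblock; rewrite rj addnS (leq_trans jn).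
by rewrite mulmxBl zE -mulmxA -mxX_S subrr.
Qed.

End Blocks.

(** * Finding a deformation *)

Section SourceStep.

Variables (K : closedFieldType) (m d0 d1 : nat).
Variable F : 'M[K]_d0 -> 'M[K]_d1 -> 'M[K]_(d0, d1) -> K.
Hypothesis regF : regular F.
Implicit Types (A : 'M[K]_d0) (B : 'M[K]_d1) (h : 'M[K]_(d0, d1)).

(** The functional needed by move_both exists as soon as the end of the longer
chain of A has an image independent of that of u modulo B^(p+1).  This is
arranged by sending the chain of A to a chain of B of the same length. *)
Lemma improvable_same_blocks A B h p q :
    nilp_triple m A B h -> F A B h != 0 -> (q <= p)%N -> (p.+1 < m)%N ->
    two_blocks A p q -> two_blocks B p q ->
  improvable m F A B.
Proof.
move=> Xh FABh qp pm [e [f [eA fA fAq eAp]]] [g [g' [gB g'B g'Bq gBp]]].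
set u := f *m A ^+ q in eAp.
have uA : u *m A = 0 by rewrite /u -mulmxA -mxX_Sr.
have uAk k phi : u *m phi = 0 -> u *m A ^+ k *m phi = 0 :> 'M_1.
  by case: k => [|k] uphi; rewrite ?expr0 ?mulmx1 // mxX_S mulmxA uA !mul0mx.
(* g2 generates a chain of length p+1 in B whose end is independent of u h'; if
   p > q one first makes u h' the end of a chain of length exactly q+1 *)
have [h' [Xh' Fh' [g2 g2B g2Bp]]] : exists h', [/\ nilp_triple m A B h', F A B h' != 0 &
    exists2 g2 : 'rV_d1, g2 *m B ^+ p.+1 = 0 &
      ~~ (g2 *m B ^+ p <= B ^+ p.+1 + u *m h')%MS].
  move: qp; rewrite leq_eqVlt => /predU1P[qp|qp].
    rewrite {}qp in fA u fAq g'B g'Bq gBp eAp uA uAk *.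
    exists h; split=> //.
    have [gin|gnot] := boolP (g *m B ^+ p <= B ^+ p.+1 + u *m h)%MS; last by exists g.
    exists g' => //; apply: contra gBp => g'in; apply: submx_trans gin _.
    rewrite addsmx_sub addsmxSl /=.
    have [a [c g'E]] := row_in_sumP g'in.
    have c0 : c != 0.
      by apply: contraNneq g'Bq => c0; rewrite g'E c0 scale0r addr0 submxMl.
    rewrite -(eqmx_scale _ c0) -[_ *: _](addKr (a *m B ^+ p.+1)) -g'E.
    rewrite addmx_sub ?addsmxSr // eqmx_opp.
    by rewrite (submx_trans (submxMl _ _)) ?addsmxSl.
  have [phi [Aphi uphi]] := separating_functional fAq.
  have uh1 : ~~ (u *m chain_hom A B q phi g' <= B ^+ q.+1)%MS.
    by rewrite chain_hom_eval // uphi mul1mx.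
  have h1AB : A *m chain_hom A B q phi g' = chain_hom A B q phi g' *m B.
    exact: chain_hom_intertwines.
  have [t [Xt Ft ut]] := adjust_hom regF Xh FABh h1AB uh1.
  exists (h + t *: chain_hom A B q phi g'); split=> //.
  exists g => //; apply/negP=> /row_in_sumP[a [c gE]].
  have gBp' : ~~ (g *m B ^+ p <= B ^+ p.+1)%MS.
    by apply: contra gBp => /submx_trans-> //; apply: addsmxSl.
  have [c0|c0] := eqVneq c 0.
    by case/negP: gBp'; rewrite gE c0 scale0r addr0 submxMl.
  case/negP: ut; rewrite -(eqmx_scale _ c0) -[_ *: _](addKr (a *m B ^+ p.+1)) -gE.
  apply: submx_trans (mxX_sub B qp); rewrite addmx_sub ?submxMl // eqmx_opp.
  by rewrite (submx_trans (submxMl _ _)) // mxX_sub.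
have [phi [Aphi uphi ephi]] := separating_functional2 eAp.
pose h1 := chain_hom A B p phi g2.
have uh1 : u *m h1 = 0 by apply: chain_hom_vanish => k; apply: uAk.
have eh1 : ~~ (e *m A ^+ p *m h1 <= B ^+ p.+1 + u *m h')%MS.
  by rewrite /h1 chain_hom_eval // ephi mul1mx.
have h1AB : A *m h1 = h1 *m B by apply: chain_hom_intertwines.
have [t [Xt Ft et]] := adjust_hom regF Xh' Fh' h1AB eh1.
apply: (move_both regF Xt Ft pm uA _ eA).
  apply: contra fAq => /submx_trans-> //; exact: mxX_sub.
by rewrite (mulmxDr u) -(scalemxAr t u) uh1 scaler0 addr0.
Qed.

(** If B has blocks of sizes p+1 and q+1, the previous lemma applies.  Otherwise
B has at most one block of size between q+1 and p+1.  If there is none, the image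
of u = f A^q climbs up to the row space of B^(p+1).  If there is one, of size
r+1 with generator g, then modulo B^(r+1) both f A^q h and e A^r h are multiples
of g B^r, the second one a nonzero multiple if h is generic; hence
u = f A^q - c e A^r is mapped into the row space of B^(r+1) for some scalar c,
and if c = 0 then f A^q h climbs further, up to B^(p+1). *)
Lemma source_improvable A B h p q :
    nilp_triple m A B h -> F A B h != 0 -> (q <= p)%N -> (p.+1 < m)%N ->
    two_blocks A p q ->
    (forall p' q', (q <= q')%N -> (q' <= p')%N -> (p' <= p)%N ->
       two_blocks B p' q' -> p' = p /\ q' = q) ->
  improvable m F A B.
Proof.
move=> Xh Fh qp pm Ablocks minimal.
have [Bblocks|nBblocks] := classic (two_blocks B p q).
  exact: (improvable_same_blocks Xh Fh qp pm Ablocks Bblocks).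
have noB r s : (q <= s)%N -> (s <= r)%N -> (r <= p)%N -> ~ two_blocks B r s.
  by move=> qs sr rp Brs; have [rE sE] := minimal r s qs sr rp Brs; subst r s.
have [e [f [eA fA fAq eAp]]] := Ablocks.
have fAqS l : (q <= l)%N -> ~~ (f *m A ^+ q <= A ^+ l.+1)%MS.
  by move=> ql; apply: contra fAq => /submx_trans-> //; apply: mxX_sub.
have move_top h' eta : nilp_triple m A B h' -> F A B h' != 0 ->
    f *m A ^+ q *m h' = eta *m B ^+ p.+1 -> improvable m F A B.
  move=> Xh' Fh' fh'.
  have uA : f *m A ^+ q *m A = 0 by rewrite -mulmxA -mxX_Sr.
  apply: (move_source regF Xh' Fh' (leqnn p) pm _ _ fh' _ eA eAp).
  - by rewrite subnn expr1.
  - by rewrite uA sub0mx.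
  - by rewrite subnn expr0 mulmx1 fAqS.
have fhB h' : nilp_triple m A B h' -> f *m h' *m B ^+ q.+1 = 0.
  by case=> _ _ AhB; rewrite -mulmxA -(intertwineX _ AhB) mulmxA fA mul0mx.
have fhE h' : nilp_triple m A B h' -> f *m A ^+ q *m h' = f *m h' *m B ^+ q.
  by case=> _ _ AhB; rewrite -mulmxA (intertwineX _ AhB) mulmxA.
have [[r [qr rp Br]]|noblock] :=
  classic (exists r, [/\ (q <= r)%N, (r <= p)%N & block B r]); last first.
  have [j /andP[qj jp] Bj|z zE] := climb (leqW qp) _ (fhB _ Xh).
    by apply: noblock; exists j.
  by apply: (move_top h z); rewrite // fhE.
have other j : (q <= j)%N -> (j <= p)%N -> j != r -> ~ block B j.
  move=> qj jp; rewrite neq_ltn => /orP[jr|rj] Bj.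
    exact: (noB r j qj (ltnW jr) rp (two_blocks_lt jr Br Bj)).
  exact: (noB j r qr (ltnW rj) jp (two_blocks_lt rj Bj Br)).
have [g gB gBr] := Br.
have uniq_r (z : 'rV_d1) :
    z *m B ^+ r.+1 = 0 -> (z *m B ^+ r <= B ^+ r.+1 + g *m B ^+ r)%MS.
  move=> zB; apply/negPn/negP=> zBr.
  by apply: (noB r r qr (leqnn r) rp); exists z, g.
have eAp' : ~~ (e *m A ^+ p <= A ^+ p.+1)%MS.
  by apply: contra eAp => /submx_trans-> //; apply: addsmxSl.
(* genericity of h: the chain of e is mapped onto the chain of g *)
have [h' [Xh' Fh' eh']] : exists h', [/\ nilp_triple m A B h', F A B h' != 0
    & ~~ (e *m A ^+ r *m h' <= B ^+ r.+1)%MS].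
  have [phi [Aphi ephi]] := separating_functional eAp'.
  have eh1 : ~~ (e *m A ^+ r *m chain_hom A B p phi g <= B ^+ r.+1)%MS.
    by rewrite chain_hom_eval // ephi mul1mx.
  have h1AB : A *m chain_hom A B p phi g = chain_hom A B p phi g *m B.
    apply: chain_hom_intertwines => //; exact: mxX_vanish gB.
  have [t [Xt Ft et]] := adjust_hom regF Xh Fh h1AB eh1.
  by exists (h + t *: chain_hom A B p phi g).
have [_ _ AhB] := Xh'.
have g_in : (g *m B ^+ r <= B ^+ r.+1 + e *m A ^+ r *m h')%MS.
  have ehE : e *m A ^+ r *m h' = e *m h' *m B ^+ r.
    by rewrite -mulmxA (intertwineX _ AhB) mulmxA.
  have /row_in_sumP[a [c eE]] :
      (e *m A ^+ r *m h' <= B ^+ r.+1 + g *m B ^+ r)%MS.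
    rewrite ehE; apply: (descend rp) => // [j /andP[rj jp]|].
      by apply: other; rewrite ?(leq_trans qr (ltnW rj)) ?neq_ltn ?rj ?orbT.
    by rewrite -mulmxA -(intertwineX _ AhB) mulmxA eA mul0mx.
  have c0 : c != 0.
    by apply: contraNneq eh' => c0; rewrite eE c0 scale0r addr0 submxMl.
  rewrite -(eqmx_scale _ c0) -[_ *: _](addKr (a *m B ^+ r.+1)) -eE.
  rewrite addmx_sub ?addsmxSr // eqmx_opp.
  by rewrite (submx_trans (submxMl _ _)) ?addsmxSl.
have [j /andP[qj jr]|z zE] := climb qr _ (fhB _ Xh').
  by apply: other; rewrite ?(leq_trans (ltnW jr)) // neq_ltn jr.
have zB : z *m B ^+ r.+1 = 0.
  rewrite mxX_Sr mulmxA -zE -mulmxA -mxX_Sr; exact: fhB.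
have /row_in_sumP[eta [c fE]] :
    (f *m A ^+ q *m h' <= B ^+ r.+1 + e *m A ^+ r *m h')%MS.
  rewrite fhE // zE; apply: submx_trans (uniq_r _ zB) _.
  by rewrite addsmx_sub addsmxSl.
have [c0|c0] := eqVneq c 0.
  rewrite c0 scale0r addr0 in fE.
  have etaB : eta *m B ^+ r.+2 = 0.
    by rewrite mxX_Sr mulmxA -fE fhE // -mulmxA -mxX_Sr fhB.
  have [j /andP[rj jp]|z' z'E] := climb (rp : (r.+1 <= p.+1)%N) _ etaB.
    by apply: other; rewrite ?(leq_trans qr (ltnW rj)) ?neq_ltn ?rj ?orbT.
  by apply: (move_top h' z'); rewrite // fE z'E.
have fAk k : (q < k)%N -> f *m A ^+ k = 0 by move=> qk; apply: mxX_vanish fA.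
(* multiplied by A^(p-r), a relation at level r becomes one that eAp excludes *)
have eAr : ~~ (e *m A ^+ r <= A ^+ r.+1 + f *m A ^+ q)%MS.
  apply/negP=> /row_in_sumP[a [b eE]]; case/negP: eAp.
  have -> : e *m A ^+ p = a *m A ^+ p.+1 + b *: (f *m A ^+ (q + (p - r))).
    rewrite -{1}(subnKC rp) mxX_D mulmxA eE mulmxDl -mulmxA -mxX_D addSn subnKC //.
    by rewrite -scalemxAl -mulmxA -mxX_D.
  apply: addmx_sub; first by rewrite (submx_trans (submxMl _ _)) ?addsmxSl.
  move: rp; rewrite leq_eqVlt => /predU1P[->|ltrp].
    by rewrite subnn addn0 scalemx_sub ?addsmxSr.
  by rewrite fAk ?scaler0 ?sub0mx // -addn1 leq_add2l subn_gt0.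
set u := f *m A ^+ q - c *: (e *m A ^+ r).
apply: (@move_source _ _ _ _ _ regF A B h' p r u e eta) => //.
- rewrite /u mulmxBl -scalemxAl -!mulmxA -!mxX_D !addnS subnKC // eA scaler0 subr0.
  by apply: fAk; rewrite ltnS leq_addr.
- rewrite /u mulmxBl -scalemxAl -!mulmxA -!mxX_Sr fA sub0r eqmx_opp.
  by rewrite scalemx_sub // submxMl.
- by rewrite /u mulmxBl -scalemxAl fE addrK.
- apply: contra eAp => uA.
  have -> : e *m A ^+ p = c^-1 *: (f *m A ^+ q *m A ^+ (p - r) - u *m A ^+ (p - r)).
    rewrite -mulmxBl /u opprB addrC subrK -scalemxAl scalerA mulVf // scale1r.
    by rewrite -mulmxA -mxX_D subnKC.
  apply: scalemx_sub; apply: addmx_sub; last first.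
    by rewrite eqmx_opp (submx_trans uA) ?addsmxSl.
  move: rp; rewrite leq_eqVlt => /predU1P[->|ltrp].
    by rewrite subnn expr0 mulmx1 addsmxSr.
  by rewrite -mulmxA -mxX_D fAk ?sub0mx // -addn1 leq_add2l subn_gt0.
apply: contra eAr => /row_in_sumP[a [b eE]].
have eE' : (1 + b * c) *: (e *m A ^+ r) = a *m A ^+ r.+1 + b *: (f *m A ^+ q).
  rewrite scalerDl scale1r {1}eE /u scalerBr scalerA -addrA subrK //.
have [bc0|bc0] := eqVneq (1 + b * c) 0; last first.
  rewrite -(eqmx_scale _ bc0) eE' addmx_sub ?scalemx_sub ?addsmxSr //.
  by rewrite (submx_trans (submxMl _ _)) ?addsmxSl.
have b0 : b != 0.
  by apply: contra_eq_neq bc0 => ->; rewrite mul0r addr0 oner_neq0.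
case/negP: (fAqS r qr); rewrite -(eqmx_scale _ b0).
rewrite -[_ *: _](addKr (a *m A ^+ r.+1)) -eE' bc0 scale0r addr0 eqmx_opp.
exact: submxMl.
Qed.

End SourceStep.

(** * Reaching the thin locus *)

Lemma climb_measure (T : Type) (P Q : T -> Prop) (mu : T -> nat) N :
    (forall x, P x -> (mu x <= N)%N) ->
    (forall x, P x -> Q x \/ exists2 y, P y & (mu x < mu y)%N) ->
  forall x, P x -> exists2 y, P y & Q y.
Proof.
move=> bound step x; have [n] := ubnP (N - mu x); elim: n x => // n IHn x.
move=> lt_n Px; have [Qx|[y Py lt_xy]] := step x Px; first by exists x.
by apply: (IHn y) => //; have := bound y Py; move: lt_n lt_xy; lia.
Qed.

Lemma nilp_triple_tr (K : closedFieldType) m d0 d1 (A : 'M[K]_d0) (B : 'M[K]_d1) h :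
  nilp_triple m A B h -> nilp_triple m B^T A^T h^T.
Proof.
case=> Am Bm AhB; split; rewrite -?trmxX ?Am ?Bm ?trmx0 //.
by rewrite -!trmx_mul AhB.
Qed.

Section Transposition.

Variables (K : closedFieldType) (m d0 d1 : nat).
Variable F : 'M[K]_d0 -> 'M[K]_d1 -> 'M[K]_(d0, d1) -> K.
Hypothesis regF : regular F.
Implicit Types (A : 'M[K]_d0) (B : 'M[K]_d1) (h : 'M[K]_(d0, d1)).

Let Ftr (B : 'M[K]_d1) (A : 'M[K]_d0) (h : 'M[K]_(d1, d0)) := F A^T B^T h^T.

Lemma improvable_tr A B : improvable m Ftr B^T A^T -> improvable m F A B.
Proof.
case=> B' [A' [h' [X' F' gain]]]; exists A'^T, B'^T, h'^T.
split; [exact: nilp_triple_tr | exact: F' |].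
suff tot_tr n0 n1 (C : 'M[K]_n0) (D : 'M[K]_n1) :
    total_rank m D^T C^T = total_rank m C D.
  by rewrite tot_tr -(tot_tr _ _ A B).
by apply: eq_bigr => k _; rewrite -!trmxX !mxrank_tr addnC.
Qed.

(** By induction on p - q: if the other module has two blocks whose sizes lie
between q+1 and p+1 and are not the same pair, pass to these. *)
Lemma improvable_of_blocks A B h p q :
    nilp_triple m A B h -> F A B h != 0 -> (q <= p)%N -> (p.+1 < m)%N ->
    two_blocks A p q \/ two_blocks B p q ->
  improvable m F A B.
Proof.
move=> Xh Fh; have [n] := ubnP (p - q); elim: n p q => // n IHn p q pqn qp pm.
have shrink p' q' : (q <= q')%N -> (q' <= p')%N -> (p' <= p)%N ->
    ~ (p' = p /\ q' = q) -> two_blocks A p' q' \/ two_blocks B p' q' ->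
    improvable m F A B.
  move=> qq' q'p' p'p ne; apply: IHn => //; last by lia.
  by move: pqn qq' q'p' p'p ne; lia.
case=> [blocksA|blocksB].
  have [[p' [q' [[qq' q'p'] [p'p ne] blocks]]]|none] := classic (exists p' q',
      [/\ (q <= q')%N /\ (q' <= p')%N, (p' <= p)%N /\ ~ (p' = p /\ q' = q)
        & two_blocks B p' q']).
    by apply: (shrink p' q') => //; right.
  apply: (source_improvable regF Xh Fh qp pm blocksA) => p' q' qq' q'p' p'p bB.
  by apply: NNPP => ne; apply: none; exists p', q'.
have [[p' [q' [[qq' q'p'] [p'p ne] blocks]]]|none] := classic (exists p' q',
    [/\ (q <= q')%N /\ (q' <= p')%N, (p' <= p)%N /\ ~ (p' = p /\ q' = q)
      & two_blocks A p' q']).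
  by apply: (shrink p' q') => //; left.
apply: improvable_tr.
have regFtr : regular Ftr.
  by move=> Bt At ht PB PA Ph; apply: regF; apply: polymx_tr.
have Fh' : Ftr B^T A^T h^T != 0 by rewrite /Ftr !trmxK.
have blocksBtr := two_blocks_tr qp blocksB.
apply: (source_improvable regFtr (nilp_triple_tr Xh) Fh' qp pm blocksBtr).
move=> p' q' qq' q'p' p'p /(two_blocks_tr q'p'); rewrite trmxK => bA.
by apply: NNPP => ne; apply: none; exists p', q'.
Qed.

(** When A^m = 0, this says that all Jordan blocks but at most one have size m. *)
Definition thin d (A : 'M[K]_d) :=
  forall p q, (q <= p)%N -> (p.+1 < m)%N -> ~ two_blocks A p q.

Lemma thin_dense A B h : nilp_triple m A B h -> F A B h != 0 ->
  exists A' B' h', [/\ nilp_triple m A' B' h', F A' B' h' != 0, thin A' & thin B'].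
Proof.
move=> Xh Fh.
pose P x := nilp_triple m x.1.1 x.1.2 x.2 /\ F x.1.1 x.1.2 x.2 != 0.
pose Q (x : 'M[K]_d0 * 'M[K]_d1 * 'M[K]_(d0, d1)) := thin x.1.1 /\ thin x.1.2.
pose mu (x : 'M[K]_d0 * 'M[K]_d1 * 'M[K]_(d0, d1)) := total_rank m x.1.1 x.1.2.
have [|||[[A' B'] h'] [X' F'] [tA tB]] :=
  @climb_measure _ P Q mu (m * (d0 + d1)) _ _ (A, B, h).
- by move=> x _; apply: total_rank_le.
- move=> [[A1 B1] h1] [/= X1 F1].
  have [[p [q [[qp pm] blocks]]]|none] := classic (exists p q,
      ((q <= p)%N /\ (p.+1 < m)%N) /\ (two_blocks A1 p q \/ two_blocks B1 p q)).
    right; have [A2 [B2 [h2 [X2 F2 gain]]]] :=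
      improvable_of_blocks X1 F1 qp pm blocks.
    by exists (A2, B2, h2).
  by left; split=> p q qp pm blocks; apply: none; exists p, q; split=> //;
    [left | right].
- by split.
- by exists A', B', h'.
Qed.

End Transposition.

(** * Thin matrices have the same ranks *)

Section Ranks.

Variables (K : fieldType) (d : nat).
Implicit Types (A : 'M[K]_d).

(** The part of the socle consisting of ends of chains of length k+1; its
dimension is the number of Jordan blocks of size greater than k. *)
Definition layer A k := (A ^+ k :&: kermx A)%MS.

Lemma rank_layer A k : (\rank (A ^+ k.+1) + \rank (layer A k) = \rank (A ^+ k))%N.
Proof. by rewrite mxX_Sr mxrank_mul_ker. Qed.

Lemma layerP A k (v : 'rV_d) :
  reflect ((exists f, v = f *m A ^+ k) /\ v *m A = 0) (v <= layer A k)%MS.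
Proof.
rewrite sub_capmx; apply: (iffP andP) => [[/submxP vf /sub_kermxP vA]|[vf vA]].
  by split.
by split; [apply/submxP | apply/sub_kermxP].
Qed.

Lemma layerS A k : (layer A k.+1 <= layer A k)%MS.
Proof. by rewrite capmxS // mxX_sub. Qed.

Lemma layer_rows m n (L : 'M[K]_(m, d)) (S : 'M[K]_(n, d)) :
  (\rank S < \rank L)%N -> exists2 v : 'rV_d, (v <= L)%MS & ~~ (v <= S)%MS.
Proof.
move=> SL; have /row_subPn[i Li] : ~~ (L <= S)%MS.
  by apply: contraL SL => LS; rewrite -leqNgt mxrankS.
by exists (row i L) => //; apply: row_sub.
Qed.

Lemma block_of_drop A k : (\rank (layer A k.+1) < \rank (layer A k))%N -> block A k.
Proof.
case/layer_rows=> v /layerP[[f vE] vA] vS; exists f.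
  by rewrite mxX_Sr mulmxA -vE.
by apply: contra vS => /submxP vf; apply/layerP; rewrite -vE in vf.
Qed.

(** The number of blocks of size k+1 is the difference of the two dimensions. *)
Lemma two_blocks_of_drop A k :
  ((\rank (layer A k.+1)).+1 < \rank (layer A k))%N -> two_blocks A k k.
Proof.
move=> drop; have [g gA gAk] := block_of_drop (ltnW drop).
have gA1 : g *m A ^+ k *m A = 0 by rewrite -mulmxA -mxX_Sr.
have /layer_rows[v /layerP[[f vE] vA] vS] :
    (\rank (layer A k.+1 + g *m A ^+ k)%MS < \rank (layer A k))%N.
  apply: leq_ltn_trans drop; apply: leq_trans (mxrank_adds_leqif _ _) _.
  by rewrite -[leqRHS]addn1 leq_add2l rank_leq_row.
exists f, g; split=> //; first by rewrite mxX_Sr mulmxA -vE.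
rewrite -vE; apply: contra vS => /row_in_sumP[a [c vE2]].
rewrite vE2; apply: addmx_sub; last by rewrite scalemx_sub ?addsmxSr.
apply: submx_trans (addsmxSl _ _); apply/layerP; split; first by exists a.
have -> : a *m A ^+ k.+1 = v - c *: (g *m A ^+ k) by rewrite vE2 addrK.
by rewrite mulmxBl vA -scalemxAl gA1 scaler0 subr0.
Qed.

Lemma layer_anti A i j : (i <= j)%N -> (\rank (layer A j) <= \rank (layer A i))%N.
Proof.
move=> ij; rewrite -(subnKC ij); elim: (j - i)%N => [|n IHn]; first by rewrite addn0.
by rewrite addnS (leq_trans _ IHn) // mxrankS // layerS.
Qed.

Lemma sum_layers A k : (\sum_(i < k) \rank (layer A i) + \rank (A ^+ k) = d)%N.
Proof.
elim: k => [|k IHk]; first by rewrite big_ord0 expr0 mxrank1.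
by rewrite big_ord_recr /= -addnA [X in (_ + X)%N]addnC rank_layer.
Qed.

End Ranks.

Section ThinRanks.

Variables (K : closedFieldType) (m d : nat).
Implicit Types (A : 'M[K]_d).

(** A total drop of two comes either from one step, giving two blocks of the same
size, or from two steps, giving blocks of different sizes. *)
Lemma thin_layers A i j : thin m A -> (i <= j)%N -> (j < m)%N ->
  (\rank (layer A i) <= (\rank (layer A j)).+1)%N.
Proof.
move=> thinA; have drop_ex l n : (\rank (layer A (l + n)) < \rank (layer A l))%N ->
    exists k, [/\ (l <= k)%N, (k < l + n)%N & block A k].
  elim: n => [|n IHn] lt; first by rewrite addn0 ltnn in lt.
  have [/IHn[k [lk kn Bk]]|le] := ltnP (\rank (layer A (l + n))) (\rank (layer A l)).
    by exists k; split=> //; rewrite addnS ltnS ltnW.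
  exists (l + n)%N; rewrite leq_addr addnS leqnn; split=> //.
  by apply: block_of_drop; rewrite -addnS (leq_trans lt).
move=> ij jm; rewrite -(subnKC ij) leqNgt; apply/negP.
have {ij jm} : (i + (j - i) < m)%N by rewrite subnKC.
move: (j - i)%N => n; elim: n i => [|n IHn] i im gap.
  by move: gap; rewrite addn0; lia.
rewrite addnS -addSn in im gap.
have [eq_i|lt_i] := leqP (\rank (layer A i)) (\rank (layer A i.+1)).
  by apply: IHn im _; apply: leq_trans gap eq_i.
have im1 : (i.+1 < m)%N by apply: leq_ltn_trans im; rewrite leq_addr.
have [/two_blocks_of_drop|le1] := ltnP (\rank (layer A i.+1)).+1 (\rank (layer A i)).
  exact: thinA.
have [|k [ik kn Bk]] := drop_ex i.+1 n; first by move: gap le1; lia.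
apply: (thinA k i (ltnW ik)); first exact: leq_ltn_trans kn im.
exact: two_blocks_lt ik Bk (block_of_drop lt_i).
Qed.

(** The dimensions of the layers decrease and take at most two consecutive
values.  Two such sequences are comparable termwise, and since both add up
to d they are equal. *)
Lemma thin_rank A A' : thin m A -> thin m A' -> A ^+ m = 0 -> A' ^+ m = 0 ->
  forall k, \rank (A ^+ k) = \rank (A' ^+ k).
Proof.
move=> thinA thinA' Am A'm.
pose s i := \rank (layer A i); pose s' i := \rank (layer A' i).
have ss' : forall i, (i < m)%N -> s i = s' i.
  have sums : (\sum_(i < m) s i = \sum_(i < m) s' i)%N.
    have := sum_layers A m; have := sum_layers A' m.
    by rewrite Am A'm mxrank0 !addn0 => -> ->.
  have eq_of_le (a b : nat -> nat) : (\sum_(i < m) a i = \sum_(i < m) b i)%N ->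
      (forall i, (i < m)%N -> (a i <= b i)%N) -> forall i, (i < m)%N -> a i = b i.
    move=> ab le_ab i im; apply/eqP; rewrite eqn_leq le_ab //=.
    move: ab; rewrite (bigD1 (Ordinal im)) //= [RHS](bigD1 (Ordinal im)) //=.
    have : (\sum_(j < m | j != Ordinal im) a j <= \sum_(j < m | j != Ordinal im) b j)%N.
      by apply: leq_sum => j _; apply: le_ab.
    by move: (\sum_(j < m | _) a j)%N (\sum_(j < m | _) b j)%N => x y; lia.
  have [/forallP le|/forallPn[i]] := boolP [forall i : 'I_m, s i <= s' i]%N.
    by apply: eq_of_le => // i im; apply: (le (Ordinal im)).
  rewrite -ltnNge => s'i j jm; apply/esym; move: j jm; apply: eq_of_le => // j jm.
  rewrite leqNgt; apply/negP => sj.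
  have [ij|/ltnW ji] := leqP i j.
    have := thin_layers thinA ij jm; have := layer_anti A' ij.
    by rewrite -/(s i) -/(s j) -/(s' i) -/(s' j); move: s'i sj; lia.
  have := thin_layers thinA' ji (ltn_ord i); have := layer_anti A ji.
  by rewrite -/(s i) -/(s j) -/(s' i) -/(s' j); move: s'i sj; lia.
move=> k; have [km|mk] := leqP k m; last first.
  by rewrite (nilp_le (ltnW mk) Am) (nilp_le (ltnW mk) A'm).
have := etrans (sum_layers A k) (esym (sum_layers A' k)).
rewrite (eq_bigr (fun i : 'I_k => s' i)) => [/addnI //|i _].
by apply: ss'; apply: leq_trans km.
Qed.

End ThinRanks.

(** * Nilpotent matrices with the same ranks are conjugate *)

Section Conjugacy.

Variables (K : closedFieldType) (d : nat).
Implicit Types (A h : 'M[K]_d).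

Lemma kermx_cokermx n (S : 'M[K]_(n, d)) : (kermx (cokermx S) <= S)%MS.
Proof. by rewrite submxE; have /eqP := mulmx_ker (cokermx S). Qed.

Lemma layer_kill A k i : layer A k *m A ^+ i.+1 = 0.
Proof.
by rewrite mxX_S mulmxA (sub_kermxP (capmxSr _ _)) mul0mx.
Qed.

Lemma layer_hom A A' h k : A *m h = h *m A' -> (layer A k *m h <= layer A' k)%MS.
Proof.
move=> AhA'; rewrite sub_capmx; apply/andP; split.
  have /submxP[D ->] : (layer A k <= A ^+ k)%MS by apply: capmxSl.
  by rewrite -mulmxA (intertwineX _ AhA') mulmxA submxMl.
apply/sub_kermxP; rewrite -mulmxA -AhA' mulmxA.
by rewrite -[A in _ *m A *m _]expr1 layer_kill mul0mx.
Qed.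

(** The rank of the map induced by h from the layer k of A to the quotient of
consecutive layers of A'. *)
Definition layer_rank A A' h k :=
  \rank (layer A k *m h *m cokermx (layer A' k.+1)).

(** If the induced map does not have the largest possible rank, then by counting
dimensions its kernel contains u outside the next layer and its image misses
the class of some g A'^k; a chain homomorphism sends u to g A'^k. *)
Lemma layer_raise A A' h k :
    (forall j, \rank (A ^+ j) = \rank (A' ^+ j)) -> A *m h = h *m A' ->
    (layer_rank A A' h k + \rank (layer A k.+1) < \rank (layer A k))%N ->
  exists2 h1 : 'M_d, A *m h1 = h1 *m A' &
    forall t, t != 0 -> (layer_rank A A' h k < layer_rank A A' (h + t *: h1) k)%N.
Proof.
move=> rkAA' AhA'; rewrite /layer_rank; set C := cokermx _ => gap.
have rk_layer j : \rank (layer A j) = \rank (layer A' j).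
  by have := rank_layer A j; rewrite !rkAA' -(rank_layer A' j) => /addnI.
have [u] : exists2 u : 'rV_d, (u <= layer A k :&: kermx (h *m C))%MS
    & ~~ (u <= layer A k.+1)%MS.
  apply: layer_rows; have := mxrank_mul_ker (layer A k) (h *m C).
  by move: gap; rewrite !mulmxA; lia.
rewrite sub_capmx => /andP[uL /sub_kermxP]; rewrite mulmxA => uhC uS.
have /submxP[z uz] := uL; have /layerP[[f uf] uA] := uL.
have [v vL' vS] : exists2 v : 'rV_d, (v <= layer A' k *m C)%MS
    & ~~ (v <= layer A k *m h *m C)%MS.
  apply: layer_rows; have := mxrank_mul_ker (layer A' k) C.
  have : (\rank (layer A' k :&: kermx C) <= \rank (layer A' k.+1))%N.
    by apply: mxrankS; apply: submx_trans (capmxSr _ _) (kermx_cokermx _).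
  by move: gap; rewrite -!rk_layer; lia.
have /submxP[D vD] := vL'; rewrite mulmxA in vD.
have /layerP[[g gE] gA'] : (D *m layer A' k <= layer A' k)%MS by apply: submxMl.
have /separating_functional[phi [Aphi uphi]] : ~~ (u <= A ^+ k.+1)%MS.
  by apply: contra uS => /submxP uk; apply/layerP.
exists (chain_hom A A' k phi g) => [|t t0].
  by apply: chain_hom_intertwines; rewrite // mxX_Sr mulmxA -gE.
have Lh1 : layer A k *m chain_hom A A' k phi g *m C = layer A k *m phi *m v.
  rewrite mulmx_sumr big_ord_recr big1 /= => [|j _]; last first.
    have -> : (k - j)%N = (k - j.+1).+1 by have := ltn_ord j; lia.
    by rewrite !mulmxA layer_kill !mul0mx.
  by rewrite add0r subnn expr0 mul1mx vD gE !mulmxA.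
rewrite mulmxDr mulmxDl -scalemxAr -scalemxAl Lh1 scalemxAl.
apply: (rank_gain (z := z)) => //.
  by rewrite -(mulmxA (layer A k)) (mulmxA z) -uz mulmxA.
by rewrite -scalemxAr (mulmxA z) -uz uphi scaler_eq0 negb_or t0 oner_neq0.
Qed.

(** A homomorphism h for which all induced maps on layers have maximal rank maps
each layer of A onto that of A', by descending induction on the layer.  Hence
it is injective on the socle of A, whose dimension equals that of the socle of
A', and so it is injective: a nonzero kernel would meet the socle. *)
Lemma conj_of_rank m A A' :
    A ^+ m = 0 -> (forall k, \rank (A ^+ k) = \rank (A' ^+ k)) ->
  exists2 T : 'M_d, T \in unitmx & A *m T = T *m A'.
Proof.
move=> Am rkAA'.
have A'm : A' ^+ m = 0 by apply/eqP; rewrite -mxrank_eq0 -rkAA' Am mxrank0.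
have rk_layer j : \rank (layer A j) = \rank (layer A' j).
  by have := rank_layer A j; rewrite !rkAA' -(rank_layer A' j) => /addnI.
pose P h := A *m h = h *m A'.
pose Q h := forall k, (k < m)%N ->
  (\rank (layer A k) <= layer_rank A A' h k + \rank (layer A k.+1))%N.
pose mu h := (\sum_(k < m) layer_rank A A' h k)%N.
have [||| h AhA' Qh] := @climb_measure _ P Q mu (m * d) _ _ 0.
- move=> h _; rewrite -[m in (m * _)%N]card_ord -sum_nat_const.
  by apply: leq_sum => k _; apply: rank_leq_col.
- move=> h Ph; have [Qh|nQh] := classic (Q h); [left; exact Qh | right].
  have [[k [km gap]]|none] := classic (exists k, (k < m)%N /\
      (layer_rank A A' h k + \rank (layer A k.+1) < \rank (layer A k))%N); last first.
    by case: nQh => k km; rewrite leqNgt; apply/negP => gap; apply: none; exists k.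
  have [h1 Ph1 raise] := layer_raise rkAA' Ph gap.
  have semi : generic (fun t => forall j, (j < m)%N ->
      (layer_rank A A' h j <= layer_rank A A' (h + t *: h1) j)%N).
    apply: generic_all => j _.
    have := @generic_rank _ _ _ (fun t => layer A j *m (h + t *: h1) *m
      cokermx (layer A' j.+1)) 0; rewrite scale0r addr0; apply.
    apply: polymxM; last exact: polymx_const.
    by apply: polymxM; [exact: polymx_const | exact: polymx_line].
  have [t [le_t /raise gain]] := generic_ex (generic_and semi (generic_neq 0)).
  exists (h + t *: h1).
    by rewrite /P mulmxDr mulmxDl -scalemxAr -scalemxAl Ph Ph1.
  rewrite /mu (bigD1 (Ordinal km)) //= [X in (_ < X)%N](bigD1 (Ordinal km)) //=.
  by rewrite -addSn; apply: leq_add => //; apply: leq_sum => j _; apply: le_t.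
- by rewrite /P mulmx0 mul0mx.
have onto n k : (m <= k + n)%N -> (layer A' k <= layer A k *m h)%MS.
  elim: n k => [|n IHn] k kn.
    rewrite addn0 in kn; apply: submx_trans (capmxSl _ _) _.
    by rewrite (nilp_le kn A'm) sub0mx.
  have [mk|km] := leqP m k; first by apply: IHn; rewrite (leq_trans mk) ?leq_addr.
  have S1 : (layer A' k.+1 <= layer A k *m h)%MS.
    apply: submx_trans (IHn _ _) _; first by rewrite addSnnS.
    exact: submxMr (layerS _ _).
  rewrite -(geq_leqif (mxrank_leqif_sup (layer_hom k AhA'))) -rk_layer.
  apply: leq_trans (Qh k km) _.
  rewrite -(mxrank_mul_ker (layer A k *m h) (cokermx (layer A' k.+1))) leq_add2l.
  rewrite rk_layer mxrankS // sub_capmx S1; apply/sub_kermxP.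
  exact: mulmx_coker.
have ker0 : (layer A 0 :&: kermx h)%MS = 0.
  apply/eqP; rewrite -mxrank_eq0 -(eqn_add2l (\rank (layer A 0 *m h))).
  rewrite mxrank_mul_ker addn0 eqn_leq mxrankM_maxl andbT rk_layer.
  by apply: mxrankS; apply: (onto m).
exists h => //; rewrite -row_free_unit -kermx_eq0.
have : kermx h *m A ^+ m = 0 by rewrite Am mulmx0.
elim: (m) => [|n IHn]; first by rewrite expr0 mulmx1 => ->.
move=> kA; apply/IHn/eqP; rewrite -submx0 -ker0 !sub_capmx expr0 submx1 /=.
apply/andP; split; apply/sub_kermxP; first by rewrite -mulmxA -mxX_Sr.
by rewrite -mulmxA (intertwineX _ AhA') mulmxA mulmx_ker mul0mx.
Qed.

End Conjugacy.

(** * Joining two points *)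

Section Join.

Variables (K : closedFieldType) (m d0 d1 : nat).
Implicit Types (A : 'M[K]_d0) (B : 'M[K]_d1) (h : 'M[K]_(d0, d1)).

Lemma adj_conj_nilp d (c : K) (P A : 'M_d) :
  (0 < m)%N -> A ^+ m = 0 -> (c *: (\adj P *m A *m P)) ^+ m = 0.
Proof.
have pow n : (c *: (\adj P *m A *m P)) ^+ n.+1 =
    (c ^+ n.+1 * \det P ^+ n) *: (\adj P *m A ^+ n.+1 *m P).
  elim: n => [|n IHn]; first by rewrite !expr1 expr0 mulr1.
  rewrite mxX_S IHn -scalemxAl -scalemxAr scalerA.
  have -> : \adj P *m A *m P *m (\adj P *m A ^+ n.+1 *m P) =
      \det P *: (\adj P *m A ^+ n.+2 *m P).
    rewrite [A ^+ n.+2]mxX_S -!mulmxA (mulmxA P) mul_mx_adj mul_scalar_mx.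
    by rewrite -!scalemxAr.
  by rewrite scalerA; congr (_ *: _); rewrite !exprS; ring.
by case: m => // n _ An; rewrite pow An mulmx0 mul0mx scaler0.
Qed.

(** Conjugation by an invertible matrix P(t) is polynomial in t only after
replacing the inverse by the adjugate, which rescales the triple.  The factors
a(t) and b(t) undo the rescaling at both ends; (cA, cB, c'h) stays in the
variety for all scalars c and c', so any interpolation of them will do. *)
Lemma join_conjugate F G A B h A' B' h' (T0 : 'M_d0) (T1 : 'M_d1) :
    (0 < m)%N -> regular F -> regular G ->
    nilp_triple m A B h -> F A B h != 0 -> nilp_triple m A' B' h' -> G A' B' h' != 0 ->
    T0 \in unitmx -> T1 \in unitmx -> A *m T0 = T0 *m A' -> B *m T1 = T1 *m B' ->
  exists A2 B2 h2, [/\ nilp_triple m A2 B2 h2, F A2 B2 h2 != 0 & G A2 B2 h2 != 0].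
Proof.
move=> m0 regF regG [Am Bm AhB] FABh [A'm B'm AhB'] Gh' uT0 uT1 AT0 BT1.
pose h3 := T0 *m h' *m invmx T1.
have Ah3 : A *m h3 = h3 *m B.
  rewrite /h3 !mulmxA AT0 -(mulmxA T0 A') AhB' -!mulmxA; do 2!congr (_ *m _).
  by rewrite -[B in RHS](mulmxK uT1) BT1 !mulmxA mulVmx // mul1mx.
pose P0 t := 1%:M + t *: (T0 - 1%:M); pose P1 t := 1%:M + t *: (T1 - 1%:M).
pose a t := 1 + t * ((\det T0 * \det T1)^-1 - 1).
pose b t := 1 + t * ((\det T0)^-1 - 1).
pose ht t := h + t *: (h3 - h).
pose At t := (a t * \det (P1 t)) *: (\adj (P0 t) *m A *m P0 t).
pose Bt t := (a t * \det (P0 t)) *: (\adj (P1 t) *m B *m P1 t).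
pose Ht t := b t *: (\adj (P0 t) *m ht t *m P1 t).
have d0T : \det T0 != 0 by rewrite -unitfE -unitmxE.
have d1T : \det T1 != 0 by rewrite -unitfE -unitmxE.
have adj1 n : \adj (1%:M : 'M[K]_n) = 1%:M.
  by have := mul_mx_adj (1%:M : 'M[K]_n); rewrite mul1mx det1.
have [A0 B0 H0] : [/\ At 0 = A, Bt 0 = B & Ht 0 = h].
  rewrite /At /Bt /Ht /a /b /P0 /P1 /ht !scale0r !mul0r !addr0 !det1 !adj1.
  by rewrite !mulr1 !scale1r !mul1mx !mulmx1.
have [A1 B1 H1] : [/\ At 1 = A', Bt 1 = B' & Ht 1 = h'].
  have at1 : [/\ a 1 = (\det T0 * \det T1)^-1, b 1 = (\det T0)^-1, P0 1 = T0,
      P1 1 = T1 & ht 1 = h3].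
    by rewrite /a /b /P0 /P1 /ht !scale1r !mul1r; split; rewrite addrC subrK.
  rewrite /At /Bt /Ht; have [-> -> -> -> ->] := at1; split.
  - rewrite -mulmxA AT0 mulmxA mul_adj_mx mul_scalar_mx scalerA.
    by rewrite -mulrA [\det T1 * _]mulrC mulVf ?mulf_neq0 // scale1r.
  - rewrite -mulmxA BT1 mulmxA mul_adj_mx mul_scalar_mx scalerA.
    by rewrite -mulrA mulVf ?mulf_neq0 // scale1r.
  - rewrite /h3 !mulmxA mul_adj_mx mulmxKV // mul_scalar_mx scalerA.
    by rewrite mulVf // scale1r.
have Xt t : nilp_triple m (At t) (Bt t) (Ht t).
  split; [exact: adj_conj_nilp | exact: adj_conj_nilp |].
  have htAB : A *m ht t = ht t *m B.
    by rewrite mulmxDr mulmxDl -scalemxAr -scalemxAl mulmxBr mulmxBl AhB Ah3.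
  rewrite -!scalemxAl -!scalemxAr !scalerA -!mulmxA.
  rewrite (mulmxA (P0 t)) (mulmxA (P1 t)) !mul_mx_adj !mul_scalar_mx.
  rewrite -!scalemxAr !scalerA (mulmxA A) htAB !mulmxA.
  by congr (_ *: _); ring.
have linear_poly c : polyfun (fun t => 1 + t * c).
  apply: polyfunD; first exact: polyfun_const.
  by apply: polyfunM; [exact: polyfun_id | exact: polyfun_const].
have PP0 : polymx P0 by apply: polymx_line.
have PP1 : polymx P1 by apply: polymx_line.
have PA : polymx At.
  apply: polymxZ; first by apply: polyfunM; [exact: linear_poly | exact: polyfun_det].
  apply: polymxM => //; apply: polymxM; [exact: polymx_adj | exact: polymx_const].
have PB : polymx Bt.
  apply: polymxZ; first by apply: polyfunM; [exact: linear_poly | exact: polyfun_det].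
  apply: polymxM => //; apply: polymxM; [exact: polymx_adj | exact: polymx_const].
have PH : polymx Ht.
  apply: polymxZ; first exact: linear_poly.
  apply: polymxM => //; apply: polymxM; [exact: polymx_adj | exact: polymx_line].
have gF : generic (fun t => F (At t) (Bt t) (Ht t) != 0).
  by apply: (@generic_polyfun _ _ 0); [apply: regF | rewrite A0 B0 H0].
have gG : generic (fun t => G (At t) (Bt t) (Ht t) != 0).
  by apply: (@generic_polyfun _ _ 1); [apply: regG | rewrite A1 B1 H1].
have [t [Ft Gt]] := generic_ex (generic_and gF gG).
by exists (At t), (Bt t), (Ht t).
Qed.

Lemma join_points F G A B h A' B' h' :
    (0 < m)%N -> regular F -> regular G ->
    nilp_triple m A B h -> F A B h != 0 -> nilp_triple m A' B' h' -> G A' B' h' != 0 ->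
  exists A2 B2 h2, [/\ nilp_triple m A2 B2 h2, F A2 B2 h2 != 0 & G A2 B2 h2 != 0].
Proof.
move=> m0 regF regG X1 F1 X2 G2.
have [A1 [B1 [h1 [{}X1 {}F1 tA1 tB1]]]] := thin_dense regF X1 F1.
have [A2 [B2 [h2 [{}X2 {}G2 tA2 tB2]]]] := thin_dense regG X2 G2.
have [A1m B1m _] := X1; have [A2m B2m _] := X2.
have [T0 uT0 AT0] := conj_of_rank A1m (thin_rank tA1 tA2 A1m A2m).
have [T1 uT1 BT1] := conj_of_rank B1m (thin_rank tB1 tB2 B1m B2m).
exact: (join_conjugate m0 regF regG X1 F1 X2 G2 uT0 uT1 AT0 BT1).
Qed.

Lemma regular_coords (p : {mpoly K[d0 * d0 + d1 * d1 + d0 * d1]}) :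
  regular (fun A B h => p.@[fun i => coords (Triple A B h) 0 i]).
Proof.
move=> At Bt ht PA PB Ph; apply: polyfun_meval => i.
have vec n k (M : K -> 'M[K]_(n, k)) j :
    polymx M -> polyfun (fun t => mxvec (M t) 0 j).
  move=> PM; case/mxvec_indexP: j => r s.
  by apply: polyfun_ext (PM r s) => t; rewrite mxvecE.
case: (split_ordP i) => [j ->|j ->]; last first.
  by apply: polyfun_ext (vec _ _ _ j Ph) => t; rewrite row_mxEr.
case: (split_ordP j) => [k ->|k ->].
  by apply: polyfun_ext (vec _ _ _ k PA) => t; rewrite !row_mxEl.
by apply: polyfun_ext (vec _ _ _ k PB) => t; rewrite row_mxEl row_mxEr.
Qed.

End Join.

Local Close Scope ring_scope.

(** * Irreducibility *)

Theorem theorem1p1 (K : closedFieldType) (m d0 d1 : nat) (hm : 0 < m) :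
  zariski_irreducible (@Xvar K d0 d1 m).
Proof.
split.
  exists (coords (Triple (0 : 'M[K]_d0) (0 : 'M[K]_d1) 0)).
  by exists (Triple 0 0 0) => //; split; rewrite /= ?expr0n ?eqn0Ngt ?hm ?mulmx0 ?mul0mx.
move=> Z1 Z2 [S1 closed1] [S2 closed2] cover.
have escape Z S : (forall v, Z v <-> Xvar m v /\ zero_locus S v) ->
    ~ (forall v : 'rV[K]_(d0 * d0 + d1 * d1 + d0 * d1), Xvar m v -> Z v) ->
    exists p M, [/\ S p, nilp_triple m (mat0 M) (mat1 M) (hmat M)
      & (p.@[fun i => coords (Triple (mat0 M) (mat1 M) (hmat M)) 0%R i] != 0)%R].
  move=> closedZ nZ; apply: NNPP => none; apply: nZ => v Xv.
  apply/closedZ; split=> // p Sp; apply/eqP/negPn/negP => pv.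
  by case: Xv pv => M XM <- pM; apply: none; exists p, M; split=> //; case: M pM {XM}.
apply: NNPP => /not_or_and[/(escape _ _ closed1)[p1 [M1 [Sp1 X1 p1M1]]]].
case/(escape _ _ closed2)=> p2 [M2 [Sp2 X2 p2M2]].
have [A [B [h [X p1M p2M]]]] :=
  join_points hm (regular_coords p1) (regular_coords p2) X1 p1M1 X2 p2M2.
have : Xvar m (coords (Triple A B h)) by exists (Triple A B h).
case/cover=> [/closed1[_ /(_ p1 Sp1)]|/closed2[_ /(_ p2 Sp2)]] p0.
  by rewrite p0 eqxx in p1M.
by rewrite p0 eqxx in p2M.
Qed.
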